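(* Let $m\ge 1$ be an integer and let $\{V_B : B\in C_m\}$ be a complete and consistent set of exponent measures, with $V_B(y_B)=\int_{S_m}\max_{j\in B}\left(\frac{w_j}{y_j}\right)dH(w_1,\ldots,w_m)$ for all $B\in C_m$ and $y_{M_m}\in(0,\infty)^m$. Then there exist $2^m-1$ non-negative functions $d_L:(0,\infty)^m\to[0,\infty)$, $L\in C_m$, such that for every $B\in C_m$ and every $y_{M_m}\in(0,\infty)^m$ $$V_B(y_B)=\sum_{L\in C_m,\ L\cap B\neq\emptyset} d_L(y_{M_m}),$$ and the functions $d_L$ are uniquely given by $$d_L(y_{M_m})=\sum_{B\in C_m,\ B\supseteq M_m\setminus L}(-1)^{|B\cap L|+1}\int_{S_m}\max_{j\in B}\left(\frac{w_j}{y_j}\right)dH(w_1,\ldots,w_m),\qquad L\in C_m,\ y_{M_m}\in(0,\infty)^m.$$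
   Context: Notation: $M_m=\{1,\ldots,m\}$; $C_m=2^{M_m}\setminus\{\emptyset\}$ is the collection of all non-empty subsets of $M_m$; $y_{M_m}=(y_1,\ldots,y_m)\in(0,\infty)^m$, and for $B\in C_m$, $y_B=\{y_i:i\in B\}$ is the subvector of $y_{M_m}$ indexed by $B$. $S_m=\{(w_1,\ldots,w_m)\in[0,\infty)^m:\sum_{i=1}^m w_i=1\}$ is the unit simplex. Definition (consistent, complete): a family of functions $\{V_B:B\in C_m\}$, with one function $V_B$ of $y_B\in(0,\infty)^{B}$ for each of the $2^m-1$ non-empty subsets $B$ of $M_m$, is a complete and consistent set of exponent measures if there is a finite (non-negative Borel) measure $H$ on $S_m$ satisfying $\int_{S_m}w_i\,dH(w_1,\ldots,w_m)=1$ for every $i\in M_m$ such that $$V_B(y_B)=\int_{S_m}\max_{j\in B}\left(\frac{w_j}{y_j}\right)dH(w_1,\ldots,w_m)$$ for every $B\in C_m$ and every $y_{M_m}\in(0,\infty)^m$. (''Complete'' refers to all $2^m-1$ non-empty subsets being present.) *)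

(* Defs.v *)
From mathcomp Require Import all_boot all_order all_algebra.
From mathcomp Require Import all_classical all_reals all_analysis.
Set Implicit Arguments.
Unset Strict Implicit.
Unset Printing Implicit Defensive.
Import Order.TTheory GRing.Theory Num.Theory.
Import numFieldNormedType.Exports.
Local Open Scope classical_set_scope.
Local Open Scope ring_scope.

Definition unit_simplex (R : realType) (m : nat) : set (m.-tuple R) :=
  [set w | (forall i : 'I_m, 0 <= tnth w i) /\ \sum_(i < m) tnth w i = 1].
Arguments unit_simplex : clear implicits.

(* A finite measure on the simplex is encoded as a finite measure on R^m, with
   the product (that is, Borel) sigma-algebra of m.-tuple R, that vanishes
   outside the simplex. *)
Definition angular_measure (R : realType) (m : nat)
    (H : {finite_measure set (m.-tuple R) -> \bar R}) : Prop :=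
  H (~` unit_simplex R m) = 0%E /\
  forall i : 'I_m, (\int[H]_(w in unit_simplex R m) (tnth w i)%:E = 1%:E)%E.

(* The default value 0 of the maximum is harmless for nonempty B, because the
   ratios are nonnegative on the simplex. They are also bounded there, so the
   real-valued integral below is that of an integrable function. *)
Definition max_integral (R : realType) (m : nat)
    (H : {finite_measure set (m.-tuple R) -> \bar R})
    (B : {set 'I_m}) (y : 'I_m -> {posnum R}) : R :=
  \int[H]_(w in unit_simplex R m)
     \big[Num.max/0]_(j in B) (tnth w j / (y j)%:num).

Definition subvector (R : realType) (m : nat) (B : {set 'I_m})
    (y : 'I_m -> {posnum R}) : {i : 'I_m | i \in B} -> {posnum R} :=
  fun i => y (sval i).

(* A family V_B of functions on (0, oo)^B; its member at the empty set is never
   constrained nor used. *)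
Definition function_family (R : realType) (m : nat) : Type :=
  forall B : {set 'I_m}, ({i : 'I_m | i \in B} -> {posnum R}) -> R.

Definition represented_by (R : realType) (m : nat) (V : function_family R m)
    (H : {finite_measure set (m.-tuple R) -> \bar R}) : Prop :=
  forall (B : {set 'I_m}) (y : 'I_m -> {posnum R}), B != finset.set0 ->
    V B (subvector y) = max_integral H B y.

Definition complete_consistent (R : realType) (m : nat)
    (V : function_family R m) : Prop :=
  exists H : {finite_measure set (m.-tuple R) -> \bar R},
    angular_measure H /\ represented_by V H.

(* As for V, the member of the family d at the empty set is irrelevant. *)
Definition nonneg_decomposition (R : realType) (m : nat)
    (V : function_family R m)
    (d : {set 'I_m} -> ('I_m -> {posnum R}) -> R) : Prop :=
  (forall (L : {set 'I_m}) (y : 'I_m -> {posnum R}), L != finset.set0 -> 0 <= d L y) /\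
  (forall (B : {set 'I_m}) (y : 'I_m -> {posnum R}), B != finset.set0 ->
    V B (subvector y) =
      \sum_(L : {set 'I_m} | (L != finset.set0) && (L :&: B != finset.set0)) d L y).

(* Main.v *)
(* For a fixed point w of the simplex put a_j = w_j / y_j.  The maxima of a over
   subsets decompose as a layer cake: max_(j in B) a_j is the length of
   {t >= 0 | exists j in B, t < a_j}, and splitting according to the set
   L = {j | t < a_j} writes it as the sum, over the L meeting B, of nonnegative
   lengths.  Moebius inversion shows that such a family is determined by the
   maxima, and expresses it as an alternating sum of them; so the layers are
   integrable in w, and integrating them gives the functions d_L. *)
Require Import Defs.
From mathcomp Require Import all_boot all_order all_algebra.
From mathcomp Require Import all_classical all_reals all_analysis.
From mathcomp Require Import measurable_realfun.
Import Order.TTheory GRing.Theory Num.Theory.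
Import numFieldNormedType.Exports.
Local Open Scope classical_set_scope.
Local Open Scope ring_scope.

(* B and x |: B contribute opposite signs. *)
Lemma sum_sign_toggle (R : pzRingType) (T : finType) (K : {set T}) (x : T)
    (g : {set T} -> R) : x \in K ->
    (forall B, g (x |: B) = g B) ->
  \sum_(B : {set T} | ~: K \subset B) (-1) ^+ (#|B :&: K| + 1) * g B = 0.
Proof.
move=> xK gx; rewrite (bigID (fun B : {set T} => x \in B)) /=.
(* Each set containing [x] is written as [x |: B]; the side condition [(x |: B) :\ x = B] says that
   [x] is not in [B]. As [x] lies in [K], adding it does not affect containing [~: K]. *)
rewrite (reindex_onto (fun B => x |: B) (fun B => B :\ x)) /=; last first.
  by move=> B /andP[_ xB]; rewrite finset.setD1K.
rewrite -[X in _ + X]opprK; apply/eqP; rewrite subr_eq0 -sumrN; apply/eqP.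
apply: eq_big => [B|B /andP[_ /eqP BE]].
  rewrite !inE eqxx /= andbT; case: (boolP (x \in B)) => xB.
    rewrite !andbF; apply/negbTE/negP => /andP[_ /eqP BE].
    by move: xB; rewrite -BE !inE eqxx.
  rewrite finset.setU1K// eqxx !andbT; apply/fintype.subsetP/fintype.subsetP => KB y yK.
    have := KB y yK; rewrite !inE => /predU1P[yx|//].
    by move: yK; rewrite yx !inE xK.
  by rewrite !inE KB ?orbT.
have xB : x \notin B by rewrite -BE !inE eqxx.
have -> : (x |: B) :&: K = x |: (B :&: K).
  by apply/setP => y; rewrite !inE; case: (eqVneq y x) => //= ->.
by rewrite cardsU1 !inE (negbTE xB) /= gx -addnA exprD expr1 mulN1r mulNr.
Qed.

(** If [L] misses some [x] of [K], toggling [x] in [B] does not change whether [L] meets [B], so the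
    terms cancel. If [L] strictly contains [K], it meets every [B] containing [~: K], and the signs
    alone cancel. If [L = K], only [B = ~: K] is lost from that vanishing sum; its sign is -1, so 1
    remains. *)
Lemma sum_sign_meet (R : pzRingType) (T : finType) (K L : {set T}) :
    K != finset.set0 -> L != finset.set0 ->
  \sum_(B : {set T} | ~: K \subset B)
     (-1) ^+ (#|B :&: K| + 1) * (L :&: B != finset.set0)%:R = (L == K)%:R :> R.
Proof.
move=> /finset.set0Pn[x0 x0K] L0.
have [/fintype.subsetP KL|/fintype.subsetPn[x xK xL]] := boolP (K \subset L); last first.
  rewrite (@sum_sign_toggle _ _ K x)//; last first.
    move=> B; congr (_ != _)%:R.
    apply/setP => y; rewrite !inE; case: (eqVneq y x) => //= ->.
    by rewrite (negbTE xL).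
  by case: eqVneq xL => // ->; rewrite xK.
have := @sum_sign_toggle R _ K x0 (fun=> 1) x0K (fun=> erefl).
have [->|LK] := eqVneq L K.
  rewrite [RHS]/= (bigD1 (~: K))//= finset.setIC finset.setICr cards0 add0n.
  rewrite expr1 mulr1.
  rewrite addrC => /subr0_eq; apply: etrans.
  rewrite [LHS](bigD1 (~: K))//= (finset.setIC (~: K)) finset.setICr eqxx.
  rewrite mulr0 add0r (eq_bigr (fun B => (-1) ^+ (#|B :&: K| + 1) * 1)) //.
  move=> B /andP[KB BK].
  congr (_ * _).
  suff -> : K :&: B != finset.set0 by rewrite ?mulr1.
  apply: contraNneq BK => KB0; rewrite finset.eqEsubset KB andbT.
  by rewrite -finset.disjoints_subset -finset.setI_eq0 finset.setIC KB0.
move=> sum0.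
rewrite (eq_bigr (fun B => (-1) ^+ (#|B :&: K| + 1) * 1)) => [//|B KB].
congr (_ * _).
suff -> : L :&: B != finset.set0 by rewrite ?mulr1.
have /fintype.subsetPn[z zL zK] : ~~ (L \subset K).
  by apply: contraNN LK => LK; rewrite finset.eqEsubset LK; apply/fintype.subsetP.
by apply/finset.set0Pn; exists z; rewrite !inE zL (fintype.subsetP KB)// inE.
Qed.

(** Expanding [f] and exchanging the two sums leaves the kernel of [sum_sign_meet], which isolates
    [d K]. *)
Lemma moebius_meet (R : comPzRingType) (T : finType) (f d : {set T} -> R) :
    (forall B, B != finset.set0 ->
       f B = \sum_(L : {set T} | (L != finset.set0) && (L :&: B != finset.set0))
               d L) ->
  forall K, K != finset.set0 ->
    d K = \sum_(B : {set T} | (B != finset.set0) && (~: K \subset B))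
            (-1) ^+ (#|B :&: K| + 1) * f B.
Proof.
move=> fd K K0.
transitivity (\sum_(B : {set T} | ~: K \subset B) \sum_(L | L != finset.set0)
   d L * ((-1) ^+ (#|B :&: K| + 1) * (L :&: B != finset.set0)%:R)).
  rewrite exchange_big /= (bigD1 K)//= -mulr_sumr sum_sign_meet// eqxx mulr1.
  rewrite big1 ?addr0// => L /andP[L0 LK].
  by rewrite -mulr_sumr sum_sign_meet// (negbTE LK) mulr0.
(* The empty [B], which occurs when [K] is the full set, contributes 0 because no [L] meets it. *)
rewrite [LHS](bigID (fun B : {set T} => B == finset.set0)) /= big1 ?add0r.
  apply: eq_big => [B|B /andP[KB B0]]; first by rewrite andbC.
  rewrite fd// mulr_sumr [RHS]big_mkcondr; apply: eq_bigr => L L0.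
  by case: ifP => _; rewrite ?mulr1 ?mulr0// mulrC.
move=> B /andP[_ /eqP ->]; apply: big1 => L _.
by rewrite finset.setI0 eqxx !mulr0.
Qed.

(* Induction on the support S of a: removing the least positive value t of a from
   all the a_j with j in S lowers by t exactly the maxima over the B meeting S. *)
Lemma bigmax_layers (R : realDomainType) (T : finType) (a : T -> R) :
    (forall j, 0 <= a j) ->
  exists2 d : {set T} -> R, (forall L, 0 <= d L) &
    forall B : {set T}, \big[Num.max/0]_(j in B) a j =
      \sum_(L : {set T} | (L != finset.set0) && (L :&: B != finset.set0)) d L.
Proof.
have [n] := ubnP #|[set i | 0 < a i]%SET|.
elim: n => // n IHn in a *; set S := [set i | 0 < a i]%SET; rewrite ltnS => Sn a0.
have aS j : j \notin S -> a j = 0.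
  by rewrite inE -leNgt => ja; apply/eqP; rewrite eq_le ja a0.
have [S0|/finset.set0Pn[i0 i0S]] := eqVneq S finset.set0.
  exists (fun=> 0) => // B; rewrite [RHS]big1//.
  apply: big1_idem => [|j _]; first exact: maxxx.
  by rewrite aS// S0 inE.
have [k kS kmin] : exists2 k, k \in S & forall j, j \in S -> a k <= a j.
  by case: (@arg_minP _ _ _ i0 (mem S) a i0S) => k kS kmin; exists k.
pose t := a k; have t0 : 0 < t by move: kS; rewrite inE.
pose b j := if j \in S then a j - t else 0.
have b0 j : 0 <= b j.
  by rewrite /b; case: ifP => // jS; rewrite subr_ge0 kmin.
have [|d d0 bd] := IHn b _ b0.
  apply: leq_trans Sn; apply: proper_card; apply/properP; split.
    by apply/fintype.subsetP => j; rewrite inE /b; case: ifP => //; rewrite ltxx.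
  by exists k => //; rewrite inE /b kS subrr ltxx.
(* Below level [t] the set where [a] exceeds the level is always [S], so the removed slab adds [t]
   to the weight of [S] alone. *)
exists (fun L => d L + (L == S)%:R * t) => [L|B].
  by rewrite addr_ge0// mulr_ge0 ?ler0n// ltW.
rewrite big_split -bd /=.
have -> : \sum_(L : {set T} | (L != finset.set0) && (L :&: B != finset.set0))
    (L == S)%:R * t = (S :&: B != finset.set0)%:R * t.
  rewrite big_mkcond (bigD1 S)//= eqxx mul1r big1 ?addr0; last first.
    by move=> L /negbTE ->; rewrite mul0r if_same.
  have -> /= : S != finset.set0 by apply/finset.set0Pn; exists i0.
  by case: ifP => _; rewrite ?mul1r ?mul0r.
have [SB|/finset.set0Pn[j /finset.setIP[jS jB]]] := eqVneq (S :&: B) finset.set0.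
  rewrite mul0r addr0; apply: eq_bigr => j jB.
  have jS : j \notin S.
    by apply/negP => jS; have := finset.in_set0 j; rewrite -SB inE jS jB.
  by rewrite /b (negbTE jS) aS.
rewrite mul1r; apply/eqP; rewrite eq_le; apply/andP; split.
  apply: bigmax_le => [|i iB].
    by apply: addr_ge0; [exact: bigmax_ge_id|exact: ltW].
  have [iS|/aS ->] := boolP (i \in S); last first.
    by apply: addr_ge0; [exact: bigmax_ge_id|exact: ltW].
  rewrite -lerBlDr; have -> : a i - t = b i by rewrite /b iS.
  exact: le_bigmax_cond.
rewrite -lerBrDr.
(* This bound handles the default 0 and the indices outside [S], where [b] is 0 rather than
   [a - t]. *)
have tB : t <= \big[Num.max/0]_(j in B) a j.
  by apply: le_trans (kmin j jS) _; exact: le_bigmax_cond.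
apply: bigmax_le => [|i iB]; first by rewrite subr_ge0.
rewrite /b; case: ifP => iS; last by rewrite subr_ge0.
by rewrite lerB//; exact: le_bigmax_cond.
Qed.

Lemma measurable_unit_simplex (R : realType) (m : nat) :
  measurable (unit_simplex R m).
Proof.
have -> : unit_simplex R m =
    \bigcap_(i in [set: 'I_m]) ((fun w => tnth w i) @^-1` `[0, +oo[) `&`
    (fun w => \sum_(i < m) tnth w i) @^-1` [set 1].
  apply/seteqP; split => w /=.
    by move=> [w0 w1]; split => // i _ /=; rewrite in_itv/= andbT.
  move=> [w0 w1]; split => // i.
  by have := w0 i I; rewrite /= in_itv/= andbT.
apply: measurableI.
  apply: fin_bigcap_measurable => [|i _]; first exact: finite_finset.
  rewrite -[X in measurable X]setTI.
  exact: measurable_tnth.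
rewrite -[X in measurable X]setTI.
by apply: measurable_sum => // i; exact: measurable_tnth.
Qed.

Lemma unit_simplex_le1 (R : realType) (m : nat) (w : m.-tuple R) (i : 'I_m) :
  unit_simplex R m w -> tnth w i <= 1.
Proof.
by move=> [w0 <-]; rewrite (bigD1 i)//= lerDl sumr_ge0.
Qed.

Lemma measurable_bigmax (R : realType) d (T : measurableType d) (D : set T)
    (I : Type) (s : seq I) (P : pred I) (h : I -> T -> R) :
    (forall i, measurable_fun D (h i)) ->
  measurable_fun D (fun x => \big[Num.max/0]_(i <- s | P i) h i x).
Proof.
move=> mh; elim: s => [|i s IHs].
  by under eq_fun do rewrite big_nil; exact: measurable_cst.
under eq_fun do rewrite big_cons.
by case: (P i) => //; exact: measurable_maxr.
Qed.

(** Coordinates are at most 1 on the simplex, so the maximum of the reciprocals of the [y j] bounds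
    the integrand, and [H] is finite. *)
Lemma integrable_bigmax_simplex (R : realType) (m : nat)
    (H : {finite_measure set (m.-tuple R) -> \bar R})
    (B : {set 'I_m}) (y : 'I_m -> {posnum R}) :
  H.-integrable (unit_simplex R m)
    (EFin \o fun w => \big[Num.max/0]_(j in B) (tnth w j / (y j)%:num)).
Proof.
have mS := @measurable_unit_simplex R m.
apply: measurable_bounded_integrable => //.
- by rewrite ltey_eq fin_num_measure.
- apply: measurable_funS measurableT _ _ => //.
  apply: measurable_bigmax => j.
  by apply: measurable_funM => //; exact: measurable_tnth.
exists (\big[Num.max/0]_(j in B) (1 / (y j)%:num)); split; first exact: num_real.
move=> M BM w Sw /=; rewrite ger0_norm; last exact: bigmax_ge_id.
apply: le_trans (ltW BM); apply: le_bigmax2 => j jB.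
by rewrite ler_pM2r// unit_simplex_le1.
Qed.

Lemma Rintegral_sum (R : realType) d (T : measurableType d)
    (mu : {measure set T -> \bar R}) (D : set T)
    (I : Type) (s : seq I) (P : pred I) (h : I -> T -> R) :
    measurable D -> (forall i, mu.-integrable D (EFin \o h i)) ->
  \int[mu]_(x in D) (\sum_(i <- s | P i) h i x) =
  \sum_(i <- s | P i) \int[mu]_(x in D) h i x.
Proof.
move=> mD ih; rewrite /Rintegral.
under eq_integral do rewrite -sumEFin.
rewrite integral_sum// sum_fine// => i _.
exact: (integrable_fin_num mD (ih i)).
Qed.

Theorem theorem2 (R : realType) (m : nat) (hm : (1 <= m)%N)
    (V : function_family R m) (hV : complete_consistent V)
    (H : {finite_measure set (m.-tuple R) -> \bar R})
    (hH : angular_measure H) (hVH : represented_by V H) :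
  (exists d : {set 'I_m} -> ('I_m -> {posnum R}) -> R,
     nonneg_decomposition V d) /\
  (forall d : {set 'I_m} -> ('I_m -> {posnum R}) -> R,
     nonneg_decomposition V d ->
     forall (L : {set 'I_m}) (y : 'I_m -> {posnum R}), L != finset.set0 ->
       d L y =
         \sum_(B : {set 'I_m} | (B != finset.set0) && (~: L \subset B))
            (-1) ^+ (#|B :&: L| + 1) * max_integral H B y).
Proof.
split; last first.
  (* Uniqueness: for fixed [y], the inversion is applied to the integrated maxima themselves. *)
  move=> d [_ dV] L y L0.
  apply: (@moebius_meet _ _ (fun B => max_integral H B y) (d^~ y)) => // B B0.
  by rewrite -hVH// dV.
pose g (y : 'I_m -> {posnum R}) (w : m.-tuple R) (B : {set 'I_m}) :=
  \big[Num.max/0]_(j in B) (tnth w j / (y j)%:num).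
(* The layers are defined by the inversion formula, not chosen from [bigmax_layers] at each [w]: a
   finite linear combination of maxima is visibly integrable in [w]. *)
pose delta y w (L : {set 'I_m}) :=
  \sum_(B : {set 'I_m} | (B != finset.set0) && (~: L \subset B))
    (-1) ^+ (#|B :&: L| + 1) * g y w B.
have deltaP y w : unit_simplex R m w ->
    (forall L, L != finset.set0 -> 0 <= delta y w L) /\
    (forall B, g y w B =
      \sum_(L : {set 'I_m} | (L != finset.set0) && (L :&: B != finset.set0))
        delta y w L).
  move=> [w0 _].
  have [|e e0 ge] := @bigmax_layers R _ (fun j => tnth w j / (y j)%:num).
    by move=> j; rewrite divr_ge0.
  (* At each point of the simplex, inversion identifies [delta] with the layers [e], from which it
     inherits nonnegativity and the decomposition. *)
  have deltaE L : L != finset.set0 -> delta y w L = e L.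
    move=> L0; apply/esym.
    by apply: (@moebius_meet _ _ (g y w) e) => // B _; exact: ge.
  split=> [L L0|B]; first by rewrite deltaE.
  by rewrite [LHS]ge; apply: eq_bigr => L /andP[L0 _]; rewrite deltaE.
exists (fun L y => \int[H]_(w in unit_simplex R m) delta y w L).
have mS := @measurable_unit_simplex R m.
split=> [L y L0|B y B0].
  by apply: Rintegral_ge0 => w /(deltaP y)[+ _]; exact.
rewrite hVH// -Rintegral_sum//.
  by apply: eq_Rintegral => w /set_mem /(deltaP y)[_ <-].
move=> L; rewrite /comp; under eq_fun do rewrite -sumEFin.
apply: integrable_sum => // C _; under eq_fun do rewrite EFinM.
exact/integrableZl/integrable_bigmax_simplex.
Qed.
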